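(* For any integer $a\ge 2$, any positive odd integer $n$ and any integer $j$ with $0\le j\le n$, modulo $\Phi_n(q)$, $$\left(\!\!\binom{an-1}{an-2n+j}\!\!\right)_q\equiv(a-1)\left(\frac{n-j}{3}\right)q^{\frac{(n-j-1)(n-j-2)}{6}-\frac{j^2+j}{2}}+\left(\frac{j}{3}\right)q^{\frac{1-j^2}{3}}.$$
   Context: $q$ is an indeterminate. $\Phi_n(q)=\prod_{1\le k\le n,\ \gcd(n,k)=1}(q-\zeta^k)$, with $\zeta$ a primitive $n$-th root of unity, is the $n$-th cyclotomic polynomial. The $q$-shifted factorial is $(a;q)_0=1$, $(a;q)_n=(1-a)(1-aq)\cdots(1-aq^{n-1})$ for $n\ge 1$. The $q$-binomial coefficient is $\begin{bmatrix}n\\k\end{bmatrix}=\frac{(q;q)_n}{(q;q)_k(q;q)_{n-k}}$ if $0\le k\le n$, and $0$ otherwise. For integers $n\ge 0$ and $-n\le j\le n$, the $q$-trinomial coefficient is $$\left(\!\!\binom{n}{j}\!\!\right)_q=\sum_{k=0}^{n}q^{k(k+j)}\begin{bmatrix}n\\k\end{bmatrix}\begin{bmatrix}n-k\\k+j\end{bmatrix}.$$ $\left(\frac{\cdot}{3}\right)$ denotes the Legendre symbol modulo $3$ (values $0,1,-1$ for arguments congruent to $0,1,2$ modulo $3$). A term whose Legendre symbol is $0$ is read as $0$ (the exponent of $q$ is an integer whenever the symbol is nonzero). A congruence $A(q)\equiv B(q)$ modulo $\Phi_n(q)$ means that $\Phi_n(q)$ divides $A(q)-B(q)$ in $\mathbb{Z}[q,q^{-1}]$.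 *)

(* Defs.v *)
From HB Require Import structures.
From mathcomp Require Import all_boot all_order all_algebra all_field.

Set Implicit Arguments.
Unset Strict Implicit.
Unset Printing Implicit Defensive.

Import Order.TTheory GRing.Theory Num.Theory.
Local Open Scope ring_scope.

Definition qpoch (F : fieldType) (x q : F) (n : nat) : F :=
  \prod_(i < n) (1 - x * q ^+ i).

(* The denominator is nonzero as soon as q is not a root of unity, in
   particular for the indeterminate q below. *)
Definition qbinom (F : fieldType) (q : F) (n : nat) (k : int) : F :=
  if 0 <= k <= n%:Z then
    qpoch q q n / (qpoch q q `|k|%N * qpoch q q (n - `|k|)%N)
  else 0.

(* Written for every integer j; the sum vanishes unless - n <= j <= n. *)
Definition qtrinom (F : fieldType) (q : F) (n : nat) (j : int) : F :=
  \sum_(k < n.+1)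
    q ^ (k%:Z * (k%:Z + j)) * qbinom q n k%:Z * qbinom q (n - k)%N (k%:Z + j).

(* When legendre3 m is nonzero, 3 divides both 1 - m ^+ 2 and
   (m - 1) * (m - 2), so that the integer divisions in exponents of q
   multiplied by legendre3 m are exact. *)
Definition legendre3 (m : int) : int :=
  if (m == 1 %[mod 3])%Z then 1
  else if (m == 2 %[mod 3])%Z then -1
  else 0.

(* The field Q(q), as the fraction field of Z[q]. *)
Definition Qq : fieldType := {fraction {poly int}}.

Definition polyQq (p : {poly int}) : Qq := tofrac p.

Definition qvar : Qq := polyQq 'X.

(* x lies in Z[q, q^-1]. *)
Definition laurent (x : Qq) : Prop :=
  exists (p : {poly int}) (m : nat), x = polyQq p / qvar ^+ m.

(* Congruence in Z[q, q^-1]; the modulus is a polynomial. *)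
Definition eq_mod_laurent (m : {poly int}) (x y : Qq) : Prop :=
  exists2 c : Qq, laurent c & x - y = polyQq m * c.

(* Main.v *)
Require Import Defs.
From mathcomp Require Import all_boot all_order all_algebra all_field.
From mathcomp Require Import ring zify.

Import Order.TTheory GRing.Theory Num.Theory.
Local Open Scope ring_scope.

(** Divisibility by 'Phi_n in Z[q, q^-1] can be tested by evaluating at a
    primitive n-th root of unity z, so both sides are compared at q = z.

    There the q-Lucas theorem strips the multiples of n from the indices: with
    T(j) the q-trinomial coefficient of order n - 1 and index j at z, the
    left-hand side becomes (a - 1) T(j) + T(n - j) ([trinom_reduction]).

    To compute T(j), rewrite the product [n-1, k] [n-1-k, k+j] of q-binomials
    as [n-1, k+j] [n-1-k-j, k]. The first factor is a signed power of z,
    because consecutive entries of row n - 1 cancel in row n, and what remains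
    is
      T(j) = (-1)^j z^(- j(j+1)/2) sum_k (-1)^k z^(k(k-1)/2) [r-k, k]
    with r = n - 1 - j ([trinom_pred_altsum]). The last sum is known in closed
    form for an arbitrary q: it is zero or a signed power of q, with period 3
    up to that power ([altsum3], [altsum_closed]). For n odd the signs combine
    into the Legendre symbol of n - j, which gives the first summand; the
    second is the value of T at n - j, with its exponent reduced modulo n. *)

(** * Gaussian binomials by Pascal recursion *)

(** A division-free form of the q-binomial, meaningful in every commutative
    ring, in particular at a root of unity. *)
Fixpoint gauss {R : comNzRingType} (q : R) (n k : nat) : R :=
  match n, k with
  | _, 0%N => 1
  | 0%N, _.+1 => 0
  | n'.+1, k'.+1 => gauss q n' k' + q ^+ k'.+1 * gauss q n' k'.+1
  end.

Section Gauss.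
Context {R : comNzRingType}.
Implicit Type q : R.

Lemma gaussS q n k :
  gauss q n.+1 k.+1 = gauss q n k + q ^+ k.+1 * gauss q n k.+1.
Proof. by []. Qed.

Lemma gauss0r q n : gauss q n 0 = 1.
Proof. by case: n. Qed.

Lemma gauss_small q n k : (n < k)%N -> gauss q n k = 0.
Proof.
elim: n k => [|n IHn] [|k] //= nk.
by rewrite !IHn ?mulr0 ?addr0 // ltnW.
Qed.

Lemma gaussnn q n : gauss q n n = 1.
Proof. by elim: n => //= n ->; rewrite gauss_small // mulr0 addr0. Qed.

(** The other Pascal rule, obtained by expanding both sides with the
    defining one; the two rules together drive the recurrences below. *)
Lemma gaussS_dual q n k : (k <= n)%N ->
  gauss q n.+1 k.+1 = gauss q n k.+1 + q ^+ (n - k) * gauss q n k.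
Proof.
elim: n k => [|n IHn] [|k] // kn.
- by rewrite /= !mulr0 add0r addr0 mulr1.
- rewrite gaussS [in LHS](IHn 0%N) // [in RHS]gaussS !gauss0r !subn0 !exprS.
  by ring.
have [->|knE] := eqVneq k n.
  by rewrite !gaussnn gauss_small // subnn mulr1 add0r.
have kn' : (k.+1 <= n)%N by rewrite ltn_neqAle knE.
have kn2 : (k <= n)%N by apply: ltnW.
rewrite gaussS [in RHS]gaussS subSS.
rewrite [gauss q n.+1 k.+1 in LHS](IHn k kn2).
rewrite [gauss q n.+1 k.+2 in LHS](IHn k.+1 kn').
rewrite [gauss q n.+1 k.+1]gaussS.
have -> : (n - k = (n - k.+1).+1)%N by lia.
by rewrite !exprS; ring.
Qed.

End Gauss.

Lemma rmorph_gauss {R S : comNzRingType} (f : {rmorphism R -> S}) (q : R) n k :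
  f (gauss q n k) = gauss (f q) n k.
Proof.
elim: n k => [|n IHn] [|k] /=; rewrite ?rmorph1 ?rmorph0 //.
by rewrite rmorphD rmorphM rmorphXn !IHn.
Qed.

Lemma qpochS {F : fieldType} (q : F) n :
  qpoch q q n.+1 = qpoch q q n * (1 - q ^+ n.+1).
Proof. by rewrite /qpoch big_ord_recr /= exprS. Qed.

Lemma qpoch_neq0 {F : fieldType} (q : F) n :
  (forall i, (0 < i <= n)%N -> q ^+ i != 1) -> qpoch q q n != 0.
Proof.
move=> q_neq1; apply/prodf_neq0 => i _; rewrite -exprS subr_eq0 eq_sym.
by apply: q_neq1; rewrite /= ltn_ord.
Qed.

(** The product formula, stated without division so that it also holds at a
    root of unity, where q-factorials may vanish. *)
Lemma gauss_qpoch {F : fieldType} (q : F) i k :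
  gauss q (i + k) k * (qpoch q q k * qpoch q q i) = qpoch q q (i + k).
Proof.
have poch0 : qpoch q q 0 = 1 by rewrite /qpoch big_ord0.
elim: i k => [|i IHi] k; first by rewrite gaussnn poch0 mul1r mulr1.
elim: k => [|k IHk]; first by rewrite addn0 gauss0r poch0 !mul1r.
have := IHi k.+1; rewrite addnS => {}IHi.
rewrite addSn addnS gaussS mulrDl {1}(qpochS q k) [in X in _ + X](qpochS q i).
have E1 : gauss q (i + k).+1 k *
    (qpoch q q k * (1 - q ^+ k.+1) * qpoch q q i.+1) =
  qpoch q q (i + k).+1 * (1 - q ^+ k.+1).
  by rewrite -IHk -addSn; ring.
rewrite E1 [qpoch q q (i + k).+2]qpochS -[in RHS]addnS.
have -> : q ^+ (i + k.+1).+1 = q ^+ k.+1 * q ^+ i.+1.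
  by rewrite -exprD addnC addSn addnS.
rewrite addnS -[X in _ = X * _]IHi -IHi; ring.
Qed.

Lemma qbinom_gauss {F : fieldType} (q : F) (n k : nat) :
  (forall i, (0 < i <= n)%N -> q ^+ i != 1) -> qbinom q n k%:Z = gauss q n k.
Proof.
move=> q_neq1; rewrite /qbinom /= lez_nat.
case: leqP => [le_kn|lt_nk]; last by rewrite gauss_small.
have poch_neq0 m : (m <= n)%N -> qpoch q q m != 0.
  by move=> mn; apply: qpoch_neq0 => i im; apply: q_neq1; lia.
rewrite -{1}(subnK le_kn) -gauss_qpoch subnK // mulfK //.
rewrite mulf_neq0 // poch_neq0 //.
exact: leq_subr.
Qed.

(** Both sides are the q-multinomial with parts k, m and N - k - m, and vanish
    when k + m exceeds N. *)
Lemma gauss_multinomialC {F : fieldType} (q : F) N k m :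
  (forall i, (0 < i <= N)%N -> q ^+ i != 1) ->
  gauss q N k * gauss q (N - k) m = gauss q N m * gauss q (N - m) k.
Proof.
move=> q_neq1.
have out k' m' : (N < k' + m')%N -> gauss q N k' * gauss q (N - k') m' = 0.
  move=> Nkm; have [Nk|kN] := ltnP N k'; first by rewrite gauss_small // mul0r.
  by rewrite [gauss q (N - k') m']gauss_small ?mulr0 //; lia.
have [Nkm|kmN] := ltnP N (k + m); first by rewrite !out // addnC.
have [s Ns] : exists s, N = (s + m + k)%N by exists (N - (k + m))%N; lia.
have poch_neq0 l : (l <= N)%N -> qpoch q q l != 0.
  by move=> lN; apply: qpoch_neq0 => i il; apply: q_neq1; lia.
have D_neq0 : qpoch q q k * qpoch q q m * qpoch q q s != 0.
  by rewrite !mulf_neq0 // poch_neq0 // Ns; lia.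
apply: (mulIf D_neq0).
have -> : (N - k = s + m)%N by lia.
have -> : (N - m = s + k)%N by lia.
have E1 := gauss_qpoch q (s + m) k; have E2 := gauss_qpoch q s m.
have E3 := gauss_qpoch q (s + k) m; have E4 := gauss_qpoch q s k.
rewrite -Ns in E1; have Ns' : N = (s + k + m)%N by lia.
rewrite -Ns' in E3.
transitivity (qpoch q q N); first by rewrite -E1 -E2; ring.
by rewrite -E3 -E4; ring.
Qed.

(** * An alternating sum of Gaussian binomials *)

Section AlternatingSum.
Context {R : comNzRingType} (q : R).

Definition altsum (r : nat) : R :=
  \sum_(0 <= k < r.+1) (-1) ^+ k * q ^+ 'C(k, 2) * gauss q (r - k) k.

(** Up to the power q ^+ r, the alternating sum with its k-th term
    multiplied by q ^- k. *)
Definition twisted_altsum (r : nat) : R :=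
  \sum_(0 <= k < r.+1)
    (-1) ^+ k * q ^+ ('C(k, 2) + (r - k)) * gauss q (r - k) k.

(** Expand by the second Pascal rule, whose factor q ^+ (n - k) produces the
    twist. *)
Lemma altsumSS r : altsum r.+2 = altsum r.+1 - twisted_altsum r.
Proof.
rewrite /altsum /twisted_altsum big_nat_recl // [in RHS]big_nat_recl //.
rewrite !subn0 !gauss0r -addrA; congr (_ + _).
rewrite big_nat_recr //= subnn gauss_small // mulr0 addr0 -sumrB.
apply: eq_big_nat => k /andP[_ kr].
have -> : (r.+2 - k.+1 = (r - k).+1)%N by lia.
have -> : (r.+1 - k.+1 = r - k)%N by lia.
have [krk|rkk] := leqP k (r - k); last first.
  by rewrite !gauss_small ?mulr0 ?subr0 //; lia.
rewrite gaussS_dual // mulrDr; congr (_ + _).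
have -> : q ^+ ('C(k, 2) + (r - k)) = q ^+ 'C(k, 2) * q ^+ k * q ^+ (r - k - k).
  by rewrite -!exprD; congr (_ ^+ _); lia.
by rewrite binS bin1 exprD exprS; ring.
Qed.

(** Expand by the first Pascal rule, whose factor q ^+ k.+1 undoes the
    twist. *)
Lemma twisted_altsumSS r :
  twisted_altsum r.+2 = q ^+ r.+2 * altsum r.+1 - q ^+ r.+1 * altsum r.
Proof.
rewrite /altsum /twisted_altsum big_nat_recl // [in RHS]big_nat_recl //.
rewrite mulrDr !subn0 !gauss0r bin0n /= add0n !expr0 !mul1r !mulr1 -addrA.
congr (_ + _).
rewrite big_nat_recr //= subnn [gauss q 0 _]gauss_small // mulr0 addr0.
rewrite !big_distrr /= -sumrB.
apply: eq_big_nat => k /andP[_ kr].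
have -> : (r.+2 - k.+1 = (r - k).+1)%N by lia.
have -> : (r.+1 - k.+1 = r - k)%N by lia.
have -> : q ^+ r.+2 = q ^+ k.+1 * q ^+ (r - k).+1.
  by rewrite -exprD; congr (_ ^+ _); lia.
have -> : q ^+ r.+1 = q ^+ k * q ^+ (r - k).+1.
  by rewrite -exprD; congr (_ ^+ _); lia.
rewrite gaussS binS bin1 exprD; move: (gauss _ _ _) (gauss _ _ _) => x y.
rewrite exprD !exprS; ring.
Qed.

Lemma altsum0 : altsum 0 = 1.
Proof. by rewrite /altsum big_nat1 bin_small // !expr0 !mul1r. Qed.

Lemma altsum1 : altsum 1 = 1.
Proof.
rewrite /altsum !big_nat_recr ?big_geq //=.
by rewrite ?['C(0, 2)]bin_small ?['C(1, 2)]bin_small //; ring.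
Qed.

Lemma altsum2 : altsum 2 = 0.
Proof.
rewrite /altsum !big_nat_recr ?big_geq //=.
by rewrite ?['C(0, 2)]bin_small ?['C(1, 2)]bin_small //; ring.
Qed.

(** By the recurrences for both sums, altsum r.+3 + q ^+ r.+1 * altsum r does
    not depend on r, and it vanishes for r = 0. *)
Lemma altsum3 r : altsum r.+3 = - q ^+ r.+1 * altsum r.
Proof.
suff E0 : altsum r.+3 + q ^+ r.+1 * altsum r = 0.
  by apply/eqP; rewrite -subr_eq0 mulNr opprK E0.
elim: r => [|r IHr].
  rewrite altsum0 altsumSS altsum2 /twisted_altsum !big_nat_recr ?big_geq //=.
  by rewrite ['C(0, 2)]bin_small ?['C(1, 2)]bin_small //; ring.
by rewrite altsumSS twisted_altsumSS -[RHS]IHr !exprS; ring.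
Qed.

End AlternatingSum.

Lemma legendre3_period3 (m : int) : legendre3 (m + 3) = legendre3 m.
Proof. by rewrite /legendre3 -[X in m + X]mul1r addrC !modzMDl. Qed.

(** The power (r (r - 1)) / 6 and the sign accumulate the factors - q ^+ r.+1 of
    [altsum3]; the sum vanishes for r = 2 modulo 3, as the symbol does. *)
Lemma altsum_closed {F : fieldType} (q : F) r : q != 0 ->
  (-1) ^+ r * altsum q r =
  (legendre3 (r%:Z + 1))%:~R * q ^ ((r%:Z * (r%:Z - 1)) %/ 6)%Z.
Proof.
move=> q_neq0; have [m] := ubnP r; elim: m r => // m IHm [|[|[|r]]] rm.
- by rewrite altsum0 mulr1.
- by rewrite altsum1 mulr1.
- by rewrite altsum2 mulr0 mul0r.
have /IHm IH : (r < m)%N by lia.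
have -> : r.+3%:Z + 1 = (r%:Z + 1) + 3 by lia.
rewrite legendre3_period3.
have -> : r.+3%:Z * (r.+3%:Z - 1) = r.+1%:Z * 6 + r%:Z * (r%:Z - 1) by lia.
rewrite divzMDl // expfzDr // -exprnP mulrCA -IH altsum3 !exprS; ring.
Qed.

(** * Evaluating Laurent polynomials at a root of unity *)

Local Notation evalC z p := (map_poly (intr : int -> algC) p).[z].

(** The remainder of p modulo the monic 'Phi_n is integral and vanishes at z; as
    'Phi_n becomes the minimal polynomial of z over the rationals, it is 0. *)
Lemma Cyclotomic_dvd {n : nat} {z : algC} (p : {poly int}) :
  n.-primitive_root z -> evalC z p = 0 -> exists c, p = 'Phi_n * c.
Proof.
move=> prim_z pz0.
have Phi_z : evalC z 'Phi_n = 0.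
  by apply/rootP; rewrite (Cintr_Cyclotomic prim_z) root_cyclotomic.
have := Pdiv.RingMonic.rdivp_eq (Cyclotomic_monic n) p.
set c := Pdiv.CommonRing.rdivp _ _; set r := Pdiv.CommonRing.rmodp _ _ => p_div.
exists c; rewrite mulrC [LHS]p_div.
suff -> : r = 0 by rewrite addr0.
have rz0 : evalC z r = 0.
  by move: pz0; rewrite p_div rmorphD rmorphM hornerD hornerM Phi_z mulr0 add0r.
have r_small : (size r < size 'Phi_n)%N.
  by rewrite Pdiv.Ring.ltn_rmodpN0 // monic_neq0 // Cyclotomic_monic.
have intC_inj : injective (intr : int -> algC) := intr_inj.
apply: (map_inj_poly intC_inj) => //; rewrite rmorph0.
have [mp [mpE mp_monic mp_dvd]] := minCpolyP z.
have rQ : map_poly (ratr : rat -> algC) (map_poly intr r) = map_poly intr r.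
  by rewrite -map_poly_comp; apply: eq_map_poly => i /=; rewrite ratr_int.
have : mp %| map_poly intr r by rewrite -mp_dvd rQ; apply/rootP.
rewrite -rQ; have [->|r_neq0] := eqVneq (map_poly (intr : int -> rat) r) 0.
  by rewrite rmorph0.
move/dvdp_leq => /(_ r_neq0).
have -> : size mp = size 'Phi_n.
  rewrite -(size_map_poly (ratr : {rmorphism rat -> algC})) -mpE.
  rewrite (minCpoly_cyclotomic prim_z).
  by rewrite -(Cintr_Cyclotomic prim_z) (size_map_inj_poly intC_inj).
have intQ_inj : injective (intr : int -> rat) := intr_inj.
by rewrite (size_map_inj_poly intQ_inj) ?mulr0z // leqNgt r_small.
Qed.

Lemma qvar_neq0 : qvar != 0.
Proof. by rewrite /qvar /polyQq tofrac_eq0 polyX_eq0. Qed.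

Lemma qvar_expr_neq1 i : (0 < i)%N -> qvar ^+ i != 1.
Proof.
move=> i_gt0; rewrite /qvar /polyQq -tofracXn -tofrac1 tofrac_eq.
apply/eqP => /(congr1 (fun p : {poly int} => size p)).
by rewrite size_polyXn size_poly1; case: i i_gt0.
Qed.

(** y is the value at z of some fraction p / q ^+ m representing x. A relation
    avoids choosing that fraction, and is compatible with all the operations
    that occur in the congruence. *)
Definition specializes (z : algC) (x : Qq) (y : algC) : Prop :=
  exists (p : {poly int}) (m : nat),
    x = polyQq p / qvar ^+ m /\ y = evalC z p / z ^+ m.

Section Specialization.
Context {z : algC} (z_neq0 : z != 0).

Lemma specializes_poly (p : {poly int}) : specializes z (polyQq p) (evalC z p).
Proof. by exists p, 0%N; rewrite !divr1. Qed.

Lemma specializesM {x1 y1 x2 y2} : specializes z x1 y1 -> specializes z x2 y2 ->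
  specializes z (x1 * x2) (y1 * y2).
Proof.
move=> [p1 [m1 [-> ->]]] [p2 [m2 [-> ->]]]; exists (p1 * p2), (m1 + m2)%N.
by rewrite /polyQq tofracM rmorphM hornerM !exprD !mulf_div.
Qed.

Lemma specializesD {x1 y1 x2 y2} : specializes z x1 y1 -> specializes z x2 y2 ->
  specializes z (x1 + x2) (y1 + y2).
Proof.
move=> [p1 [m1 [-> ->]]] [p2 [m2 [-> ->]]].
exists (p1 * 'X^m2 + p2 * 'X^m1), (m1 + m2)%N.
rewrite /polyQq tofracD !tofracM !tofracXn !rmorphD !rmorphM /= !map_polyXn.
rewrite hornerD !hornerM !hornerXn !exprD.
by split; rewrite addf_div // expf_neq0 // qvar_neq0.
Qed.

Lemma specializes_int (i : int) : specializes z i%:~R i%:~R.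
Proof.
have := specializes_poly i%:~R.
by rewrite /polyQq !rmorph_int -[_.[z]]/(horner_eval z _) rmorph_int.
Qed.

Lemma specializes_qexp (e : int) : specializes z (qvar ^ e) (z ^ e).
Proof.
case: e => m.
  have := specializes_poly 'X^m.
  by rewrite /polyQq tofracXn map_polyXn hornerXn.
exists 1, m.+1; rewrite /polyQq tofrac1 rmorph1 hornerC !NegzE -!exprnN.
by rewrite !div1r.
Qed.

Lemma specializes_gauss n k : specializes z (gauss qvar n k) (gauss z n k).
Proof.
have := specializes_poly (gauss 'X n k).
rewrite /polyQq !rmorph_gauss /= map_polyX -[_.[z]]/(horner_eval z _).
by rewrite rmorph_gauss /= /horner_eval hornerX.
Qed.

Lemma specializes_sum n (f : nat -> Qq) (g : nat -> algC) :
  (forall k, specializes z (f k) (g k)) ->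
  specializes z (\sum_(k < n) f k) (\sum_(k < n) g k).
Proof.
move=> fg; elim: n => [|n IHn].
  by rewrite !big_ord0; exact: (specializes_int 0).
by rewrite !big_ord_recr; apply: specializesD.
Qed.

Lemma specializes_qtrinom n j : specializes z (qtrinom qvar n j%:Z)
  (\sum_(k < n.+1) z ^+ (k * (k + j)) * gauss z n k * gauss z (n - k) (k + j)).
Proof.
apply: (specializes_sum n.+1
  (fun k => qvar ^ (k%:Z * (k%:Z + j%:Z))
     * qbinom qvar n k%:Z * qbinom qvar (n - k)%N (k%:Z + j%:Z))
  (fun k => z ^+ (k * (k + j)) * gauss z n k * gauss z (n - k) (k + j))).
move=> k; rewrite -PoszD -PoszM.
have nr m i : (0 < i <= m)%N -> qvar ^+ i != 1.
  by case/andP=> /qvar_expr_neq1.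
rewrite !qbinom_gauss; try exact: nr.
apply: specializesM (specializes_gauss _ _).
by apply: specializesM (specializes_gauss _ _); apply: specializes_qexp.
Qed.

Lemma specializes_congruent n x1 x2 y : n.-primitive_root z ->
  specializes z x1 y -> specializes z x2 y -> eq_mod_laurent 'Phi_n x1 x2.
Proof.
move=> prim_z [p1 [m1 [-> y1]]] [p2 [m2 [-> y2]]].
have [c cE] : exists c, p1 * 'X^m2 - p2 * 'X^m1 = 'Phi_n * c.
  apply: Cyclotomic_dvd prim_z _; apply/eqP.
  rewrite rmorphB !rmorphM /= !map_polyXn hornerD hornerN !hornerM !hornerXn.
  by rewrite subr_eq0 -eqr_div ?expf_neq0 // -y1 -y2.
exists (polyQq c / qvar ^+ (m1 + m2)); first by exists c, (m1 + m2)%N.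
rewrite mulrA /polyQq -tofracM -cE tofracB !tofracM !tofracXn exprD -mulNr.
by rewrite addf_div ?mulNr // expf_neq0 // qvar_neq0.
Qed.

End Specialization.

(** * Reduction of an exponent modulo n *)

(** With n = 2 h + 1, the difference of the two exponents is a multiple of n
    because n (n + 1) / 2 = (h + 1) n. *)
Lemma trinom_exponent_subn (n h j : int) :
  n = 2 * h + 1 -> (j %% 3)%Z != 0 ->
  ((j - 1) * (j - 2) %/ 6)%Z - (((n - j) ^+ 2 + (n - j)) %/ 2)%Z =
  ((1 - j ^+ 2) %/ 3)%Z + (j - (h + 1)) * n.
Proof.
move=> -> j_mod3.
have [t tE] : exists t, (j - 1) * (j - 2) = t * 6.
  have [i jE] : exists i,
      j = 6 * i + 1 \/ j = 6 * i + 2 \/ j = 6 * i + 4 \/ j = 6 * i + 5.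
    by exists (j %/ 6)%Z; lia.
  by exists ((j - 1) * (j - 2) %/ 6)%Z; case: jE => [->|[->|[->|->]]]; lia.
have [u uE] : exists u, 1 - j ^+ 2 = u * 3.
  have [i jE] : exists i, j = 3 * i + 1 \/ j = 3 * i + 2.
    by exists (j %/ 3)%Z; lia.
  by exists ((1 - j ^+ 2) %/ 3)%Z; case: jE => ->; lia.
have [v vE] : exists v, (2 * h + 1 - j) ^+ 2 + (2 * h + 1 - j) = v * 2.
  have [i jE] : exists i, j = 2 * i \/ j = 2 * i + 1.
    by exists (j %/ 2)%Z; lia.
  exists (((2 * h + 1 - j) ^+ 2 + (2 * h + 1 - j)) %/ 2)%Z.
  by case: jE => ->; lia.
by rewrite tE uE vE !mulzK //; nia.
Qed.

(** * Gaussian binomials at a root of unity *)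

Lemma prim_root_neq0 {F : fieldType} {n : nat} {z : F} :
  n.-primitive_root z -> z != 0.
Proof.
move=> prim_z; apply: contra_eq_neq (prim_expr_order prim_z) => ->.
by rewrite expr0n gtn_eqF ?(prim_order_gt0 prim_z) // eq_sym oner_neq0.
Qed.

Section RootOfUnity.
Context {F : fieldType} {n : nat} {z : F} (prim_z : n.-primitive_root z).

Let n_gt0 : (0 < n)%N := prim_order_gt0 prim_z.
Let zn1 : z ^+ n = 1 := prim_expr_order prim_z.

Let z_neq1 m : (m < n)%N -> forall i, (0 < i <= m)%N -> z ^+ i != 1.
Proof.
move=> mn i /andP[i_gt0 im].
rewrite -(prim_order_dvd prim_z) gtnNdvd //; exact: leq_ltn_trans mn.
Qed.

(** The q-factorial of n vanishes at z, those of smaller numbers do not. *)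
Lemma gauss_prim_eq0 k : (0 < k < n)%N -> gauss z n k = 0.
Proof.
case/andP=> k_gt0 kn; have := gauss_qpoch z (n - k) k.
rewrite subnK ?(ltnW kn) //.
have -> : qpoch z z n = 0.
  by rewrite -(prednK n_gt0) qpochS (prednK n_gt0) zn1 subrr mulr0.
move/eqP; rewrite !mulf_eq0 => /or3P[/eqP-> // | |];
  by rewrite (negbTE (qpoch_neq0 _ _ (z_neq1 _ _))) //; lia.
Qed.

(** Adding n to the upper index: the two terms come from the only nonzero
    values of gauss z n, at 0 and n. *)
Lemma gauss_prim_addn m k :
  gauss z (m + n) k =
  gauss z m k + (if (n <= k)%N then gauss z m (k - n) else 0).
Proof.
elim: m k => [|m IHm] [|k].
- by rewrite !gauss0r leqNgt n_gt0 addr0.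
- rewrite add0n [gauss z 0 _]gauss_small // add0r.
  have [nk|kn] := leqP n k.+1; last by rewrite gauss_prim_eq0.
  have [->|nk'] := eqVneq n k.+1; first by rewrite gaussnn subnn.
  by rewrite !gauss_small //; lia.
- by rewrite !gauss0r leqNgt n_gt0 addr0.
rewrite addSn !gaussS !IHm.
have [nk|kn] := leqP n k.
  rewrite (leqW nk) subSn // gaussS.
  have -> : z ^+ k.+1 = z ^+ (k - n).+1.
    by rewrite -subSn // -[RHS]mulr1 -zn1 -exprD subnK // leqW.
  by ring.
have [nk|kn'] := leqP n k.+1; last by ring.
have -> : k.+1 = n by lia.
by rewrite subnn !gauss0r zn1; ring.
Qed.

(** The q-Lucas theorem. *)
Lemma gauss_prim_lucas a b c d : (b < n)%N -> (d < n)%N ->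
  gauss z (a * n + b) (c * n + d) = 'C(a, c)%:R * gauss z b d.
Proof.
move=> bn dn; elim: a c => [|a IHa] [|c].
- by rewrite bin0 mul1r.
- by rewrite gauss_small ?mul0r //; nia.
- have -> : (a.+1 * n + b = a * n + b + n)%N by nia.
  by rewrite gauss_prim_addn leqNgt dn addr0 IHa !bin0.
have -> : (a.+1 * n + b = a * n + b + n)%N by nia.
rewrite gauss_prim_addn IHa binS natrD mulrDl.
have -> : (n <= c.+1 * n + d)%N by nia.
have -> : (c.+1 * n + d - n = c * n + d)%N by nia.
by rewrite IHa.
Qed.

(** Consecutive entries of row n - 1 cancel in row n, up to a power of z. *)
Lemma gauss_prim_pred m : (m < n)%N ->
  z ^+ 'C(m.+1, 2) * gauss z n.-1 m = (-1) ^+ m.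
Proof.
elim: m => [|m IHm] mn; first by rewrite gauss0r bin_small // mulr1.
have := gauss_prim_eq0 m.+1; rewrite mn => /(_ isT).
rewrite -{1}(prednK n_gt0) gaussS => /eqP; rewrite addrC addr_eq0 => /eqP E.
rewrite binS bin1 exprD -mulrA E mulrN IHm ?exprS ?mulN1r //; exact: ltnW.
Qed.

(** * The q-trinomial coefficients of order n - 1 at a root of unity *)

Definition trinom_pred (j : nat) : F :=
  \sum_(0 <= k < n)
    z ^+ (k * (k + j)) * gauss z n.-1 k * gauss z (n.-1 - k) (k + j).

(** Exchanging the roles of k and k + j in the q-multinomial makes the factor
    gauss z n.-1 (k + j), a signed power of z, appear. *)
Lemma trinom_pred_altsum j : (j < n)%N ->
  z ^+ 'C(j.+1, 2) * trinom_pred j = (-1) ^+ j * altsum z (n.-1 - j).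
Proof.
move=> jn; rewrite /trinom_pred /altsum.
rewrite (@big_cat_nat _ _ _ (n.-1 - j).+1) //=; last by lia.
rewrite [X in _ + X]big_nat [X in _ + X]big1 ?addr0; last first.
  move=> k /andP[jk kn].
  by rewrite [gauss z (n.-1 - k) _]gauss_small ?mulr0 //; lia.
rewrite !big_distrr /=; apply: eq_big_nat => k /andP[_ kr].
rewrite -mulrA gauss_multinomialC; last by apply: z_neq1; lia.
have -> : (n.-1 - (k + j) = n.-1 - j - k)%N by lia.
have expE : ('C(j.+1, 2) + k * (k + j) = 'C(k, 2) + 'C((k + j).+1, 2))%N.
  elim: k {kr} => [|k IHk]; first by rewrite addn0 add0n.
  by rewrite addSn ['C(k.+1, 2)]binS ['C((k + j).+2, 2)]binS !bin1; nia.
rewrite !mulrA -exprD expE exprD.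
have kjn : (k + j < n)%N by lia.
rewrite -[_ * _ * gauss z n.-1 _]mulrA (gauss_prim_pred _ kjn) exprD.
by ring.
Qed.

Let z_neq0 : z != 0 := prim_root_neq0 prim_z.

Lemma trinom_pred_n : trinom_pred n = 0.
Proof.
rewrite /trinom_pred big_nat big1 // => k /andP[_ kn].
by rewrite [gauss z (n.-1 - k) _]gauss_small ?mulr0 //; lia.
Qed.

(** For n odd, j and n - 1 - j have the same parity, so that the sign in
    [trinom_pred_altsum] is the one in [altsum_closed]. *)
Lemma trinom_pred_closed j : odd n -> (j <= n)%N ->
  trinom_pred j = (legendre3 (n%:Z - j%:Z))%:~R
    * z ^ (((n%:Z - j%:Z - 1) * (n%:Z - j%:Z - 2) %/ 6)%Z
           - ((j%:Z ^+ 2 + j%:Z) %/ 2)%Z).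
Proof.
move=> n_odd; rewrite leq_eqVlt => /orP[/eqP->|jn].
  by rewrite trinom_pred_n subrr mul0r.
have tri : ((j%:Z ^+ 2 + j%:Z) %/ 2)%Z = 'C(j.+1, 2)%:Z.
  by have := mul_bin_diag j.+1 1; rewrite bin1 /=; lia.
have sign : (-1) ^+ j = (-1) ^+ (n.-1 - j) :> F.
  by rewrite -signr_odd -[RHS]signr_odd; congr (_ ^+ nat_of_bool _); lia.
rewrite tri expfzDr // mulrA -invr_expz.
have -> : n%:Z - j%:Z - 2 = (n.-1 - j)%:Z - 1 by lia.
have -> : n%:Z - j%:Z - 1 = (n.-1 - j)%:Z by lia.
have -> : n%:Z - j%:Z = (n.-1 - j)%:Z + 1 by lia.
rewrite -altsum_closed // -sign -(trinom_pred_altsum j jn) -exprnP.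
by rewrite mulrAC mulfV ?mul1r // expf_neq0.
Qed.

Lemma prim_expz_eq (x y k : int) : x = y + k * n%:Z -> z ^ x = z ^ y.
Proof.
move=> ->; rewrite expfzDr // [k * _]mulrC -exprz_exp.
by rewrite -exprnP zn1 exp1rz mulr1.
Qed.

(** The preceding closed form at n - j, with its exponent reduced modulo n by
    [trinom_exponent_subn]. *)
Lemma trinom_pred_subn j : odd n -> (j <= n)%N ->
  trinom_pred (n - j) =
  (legendre3 j%:Z)%:~R * z ^ ((1 - j%:Z ^+ 2) %/ 3)%Z.
Proof.
move=> n_odd jn; rewrite trinom_pred_closed ?leq_subr //.
have -> : n%:Z - (n - j)%N%:Z = j%:Z by lia.
have [->|j_neq0] := eqVneq (legendre3 j%:Z) 0; first by rewrite !mul0r.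
congr (_ * _).
have j_mod3 : (j%:Z %% 3)%Z != 0.
  by apply: contraNneq j_neq0 => j0; rewrite /legendre3 j0.
apply: (prim_expz_eq _ _ (j%:Z - (n./2%:Z + 1))).
have -> : (n - j)%N%:Z = n%:Z - j%:Z by lia.
by apply: trinom_exponent_subn => //; lia.
Qed.

(** Only the indices k < n contribute, and by the q-Lucas theorem the second
    q-binomial depends on whether k + j reaches n; the symmetry of
    the q-multinomial turns the overflowing part into the second sum. *)
Lemma trinom_reduction a j : (j <= n)%N ->
  \sum_(k < (a.+2 * n - 1).+1) z ^+ (k * (k + (a * n + j)))
     * gauss z (a.+2 * n - 1) k * gauss z (a.+2 * n - 1 - k) (k + (a * n + j))
  = a.+1%:R * trinom_pred j + trinom_pred (n - j).
Proof.
move=> jn; set N := (a.+2 * n - 1)%N; set J := (a * n + j)%N.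
have NE : N = (a.+1 * n + n.-1)%N by rewrite /N; nia.
rewrite -(big_mkord xpredT
  (fun k => z ^+ (k * (k + J)) * gauss z N k * gauss z (N - k) (k + J))).
rewrite (@big_cat_nat _ _ _ n) //=; last by nia.
rewrite [X in _ + X]big_nat [X in _ + X]big1 ?addr0; last first.
  move=> k /andP[nk kN].
  by rewrite [gauss z (N - k) _]gauss_small ?mulr0 // /J; nia.
have zmod i l : z ^+ (i + l * n) = z ^+ i.
  by rewrite exprD [(l * n)%N]mulnC exprM zn1 expr1n mulr1.
transitivity (a.+1%:R * trinom_pred j +
  \sum_(0 <= k < n)
    if (n <= k + j)%N then
      z ^+ (k * (k + j)) * gauss z n.-1 k * gauss z (n.-1 - k) (k + j - n)
    else 0).
  rewrite big_distrr -big_split /=; apply: eq_big_nat => k /andP[_ kn].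
  have -> : gauss z N k = gauss z n.-1 k.
    rewrite NE -[k in LHS]/(0 * n + k)%N gauss_prim_lucas ?bin0 ?mul1r //.
    by lia.
  have -> : z ^+ (k * (k + J)) = z ^+ (k * (k + j)).
    rewrite /J (_ : k * _ = k * (k + j) + (k * a) * n)%N; last by nia.
    exact: zmod.
  have -> : (N - k = a.+1 * n + (n.-1 - k))%N by lia.
  have [nkj|kjn] := leqP n (k + j).
    have -> : (k + J = a.+1 * n + (k + j - n))%N by rewrite /J; nia.
    rewrite gauss_prim_lucas ?binn; [|lia|lia].
    rewrite [gauss z _ (k + j)]gauss_small; last by lia.
    by rewrite !mulr0 add0r mul1r.
  have -> : (k + J = a * n + (k + j))%N by rewrite /J; lia.
  rewrite gauss_prim_lucas //; last by lia.
  by rewrite binSn addr0 mulrCA.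
congr (_ + _); rewrite /trinom_pred.
rewrite (@big_cat_nat _ _ _ (n - j)) ?leq_subr //=.
rewrite big_nat big1 ?add0r; last first.
  by move=> k /andP[_ kj]; rewrite leqNgt (_ : k + j < n)%N //; lia.
rewrite [RHS](@big_cat_nat _ _ _ j) //=.
rewrite [X in _ = _ + X]big_nat [X in _ = _ + X]big1 ?addr0; last first.
  move=> k /andP[jk kn].
  by rewrite [gauss z (n.-1 - k) _]gauss_small ?mulr0 //; lia.
(* The overflowing part is reindexed by k := k + (n - j). *)
rewrite -{1}[(n - j)%N]add0n big_addn subKn //.
apply: eq_big_nat => k /andP[_ kj].
have -> : (n <= k + (n - j) + j)%N by lia.
have -> : (k + (n - j) + j - n = k)%N by lia.
have -> : ((k + (n - j)) * (k + (n - j) + j)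
    = k * (k + (n - j)) + (k + (n - j)) * n)%N by nia.
rewrite zmod -!mulrA gauss_multinomialC // => i /andP[i_gt0 iN].
by rewrite -(prim_order_dvd prim_z) gtnNdvd //; lia.
Qed.

End RootOfUnity.

Theorem theorem1p5 (a n j : nat) (ha : (2 <= a)%N) (hn : odd n)
    (hj : (j <= n)%N) :
  eq_mod_laurent 'Phi_n
    (qtrinom qvar (a * n - 1)%N (a%:Z * n%:Z - 2 * n%:Z + j%:Z))
    ((a%:R - 1) * (legendre3 (n%:Z - j%:Z))%:~R
       * qvar ^ (((n%:Z - j%:Z - 1) * (n%:Z - j%:Z - 2) %/ 6)%Z
                 - ((j%:Z ^+ 2 + j%:Z) %/ 2)%Z)
     + (legendre3 j%:Z)%:~R * qvar ^ ((1 - j%:Z ^+ 2) %/ 3)%Z).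
Proof.
have [z prim_z] := C_prim_root_exists (odd_gt0 hn).
have z_neq0 : z != 0 by rewrite (prim_root_neq0 prim_z).
case: a ha => [|[|a]] // _.
have -> : a.+2%:Z * n%:Z - 2 * n%:Z + j%:Z = (a * n + j)%N%:Z by lia.
apply: (specializes_congruent z_neq0 _ _ _ _ prim_z
  (specializes_qtrinom z_neq0 _ _)).
rewrite (trinom_reduction prim_z) // (trinom_pred_closed prim_z) //.
rewrite (trinom_pred_subn prim_z) // mulrA.
have -> : a.+2%:R - 1 = a.+1%:Z%:~R :> Qq by rewrite -addn1 natrD addrK.
apply: (specializesD z_neq0); last first.
  exact: specializesM (specializes_int _) (specializes_qexp _).
apply: specializesM (specializes_qexp _).
exact: specializesM (specializes_int _) (specializes_int _).
Qed.
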